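(* $\mathrm{cov}(\mathcal M)\le\widehat{\mathsf{\Sigma}}\le\widehat{\mathsf{\Delta}}\le\min\{\mathfrak d,\mathfrak r,\mathrm{non}(\mathcal N)\}$.
   Context: $[\omega]^\omega$ is the family of all infinite subsets of $\omega$. $I_\omega$ is the set of all involutions $h:\omega\to\omega$ (i.e. $h\circ h=\mathrm{id}$) having at most one fixed point. Define $$\widehat{\mathsf{\Delta}}=\min\{|\mathcal A|:\mathcal A\subseteq[\omega]^\omega\ \wedge\ \forall h\in I_\omega\ \exists A\in\mathcal A\ \ |h[A]\cap A|<\omega\},$$ $$\widehat{\mathsf{\Sigma}}=\min\{|\mathcal A|:\mathcal A\subseteq[\omega]^\omega\ \wedge\ \forall h\in I_\omega\ \exists A,B\in\mathcal A\ \ |h[A]\cap B|<\omega\}.$$ For $f,g\in\omega^\omega$, $f\le^* g$ means that $\{n:f(n)\not\le g(n)\}$ is finite; $a\subseteq^* b$ means that $a\setminus b$ is finite. $\mathfrak d=\min\{|D|:D\subseteq\omega^\omega,\ \forall f\in\omega^\omega\,\exists g\in D\ f\le^* g\}$; $\mathfrak r=\min\{|R|:R\subseteq[\omega]^\omega,\ \forall a\in[\omega]^\omega\,\exists r\in R\ (r\subseteq^* a\text{ or }r\subseteq^*\omega\setminus a)\}$. $\mathcal M$ and $\mathcal N$ are the $\sigma$-ideals of meager sets and of Lebesgue null sets in the real line; $\mathrm{cov}(\mathcal M)$ is the smallest cardinality of a subfamily of $\mathcal M$ whose union is $\mathbb R$; $\mathrm{non}(\mathcal N)$ is the smallest cardinality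 of a subset of $\mathbb R$ not in $\mathcal N$. *)

(* Defs.v *)
From HB Require Import structures.
From mathcomp Require Import all_boot all_order all_algebra.
From mathcomp Require Import all_classical all_reals all_analysis.

Set Implicit Arguments.
Unset Strict Implicit.
Unset Printing Implicit Defensive.

Import Order.TTheory GRing.Theory Num.Theory.
Import numFieldNormedType.Exports.

Local Open Scope classical_set_scope.
Local Open Scope card_scope.

(* A cardinal is represented by any type of that cardinality. *)

Definition cardinal_le (K L : Type) : bool := [set: K] #<= [set: L].
Notation "K <=c L" := (cardinal_le K L) (at level 70, no associativity).

Definition cardinal_min (K L : Type) : Type := if K <=c L then K else L.

Definition of_least_card (T : Type) (P : set (set T)) : set (set T) :=
  [set A | P A /\ forall B, P B -> A #<= B].

(* Cardinals are well-founded: a maximal set of selectors of the members of P,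
   any two of which differ on every member, exhausts some member A, and
   evaluating at B the selector through a point of A injects A into B. *)
Lemma ex_least_card (T : Type) (P : set (set T)) :
  P !=set0 -> of_least_card P !=set0.
Proof.
move=> [A0 PA0].
have [P0|nP0] := pselect (P set0).
  by exists set0; split=> // B _; exact: subset_card_le.
have PN A : P A -> A !=set0.
  by move=> PA; apply/set0P/eqP => A_0; apply: nP0; rewrite -A_0.
have [t0 _] := PN _ PA0.
pose Q (S : set (set T -> T)) :=
  (forall f, S f -> forall A, P A -> A (f A)) /\
  (forall f g, S f -> S g -> f <> g -> forall A, P A -> f A <> g A).
have [|S [[Sin Sdiff] Smax]] := @Zorn_bigcup _ Q.
  move=> F FQ Ftot; split=> [f [S FS Sf]|f g [S FS Sf] [S' FS' S'g]].
    exact: (FQ _ FS).1.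
  have [SS'|S'S] := Ftot _ _ FS FS'.
    by apply: (FQ _ FS').2 => //; exact: SS'.
  by apply: (FQ _ FS).2 => //; exact: S'S.
have [A [PA Aex]] :
    exists A, P A /\ forall x, exists f, A x -> S f /\ f A = x.
  apply: contrapT => noA.
  have /choice[h hP] A :
      exists x, P A -> A x /\ forall f, S f -> f A <> x.
    have [PA|nPA] := pselect (P A); last by exists t0.
    apply: contrapT => nx; apply: noA; exists A; split=> // x.
    have [Ax|nAx] := pselect (A x); last by exists (fun=> t0).
    apply: contrapT => nf; apply: nx; exists x => _; split=> // f Sf fAx.
    by apply: nf; exists f.
  have Sh : ~ S h by move=> Sh; exact: ((hP _ PA0).2 _ Sh).
  have : ~ Q (h |` S).
    by apply: Smax; split; [exact: subsetUr | move=> hS; apply/Sh/hS; left].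
  apply; split=> [f [->|Sf] A PA|f g [->|Sf] [->|Sg] fg A PA //].
  - exact: (hP _ PA).1.
  - exact: Sin Sf _ PA.
  - by apply/nesym; exact: (hP _ PA).2.
  - exact: (hP _ PA).2.
  - exact: Sdiff Sf Sg fg _ PA.
have [e eP] := choice Aex.
exists A; split=> // B PB.
have eB : set_fun A B (fun x => e x B).
  by move=> x Ax; exact: Sin (eP _ Ax).1 _ PB.
have eI : {in A &, injective (fun x => e x B)}.
  move=> x y; rewrite !inE => Ax Ay exy.
  have exey : e x = e y.
    apply: contrapT => ne.
    exact: Sdiff (eP _ Ax).1 (eP _ Ay).1 ne _ PB exy.
  by rewrite -(eP _ Ax).2 -(eP _ Ay).2 exey.
rewrite -(card_le_eql (inj_card_eq eI)); apply: subset_card_le.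
by move=> _ [x Ax <-]; exact: eB.
Qed.

(* min {|A| : P A}, as the underlying type of a chosen A of least cardinality;
   by [ex_least_card] the choice is legitimate as soon as P is inhabited. *)
Definition min_card (T : Type) (P : set (set T)) : Type :=
  set_type (xget (set0 : set T) (of_least_card P)).

Definition inf_subsets : set (set nat) := [set A | infinite_set A].

Definition I_omega : set (nat -> nat) :=
  [set h | involutive h /\ is_subset1 [set n | h n = n]].

Definition Delta_hat : Type :=
  min_card [set F : set (set nat) | F `<=` inf_subsets /\
    forall h, I_omega h -> exists2 A, F A & finite_set (h @` A `&` A)].

Definition Sigma_hat : Type :=
  min_card [set F : set (set nat) | F `<=` inf_subsets /\
    forall h, I_omega h ->
      exists A B, [/\ F A, F B & finite_set (h @` A `&` B)]].

Definition le_star (f g : nat -> nat) : Prop :=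
  finite_set [set n | ~ (f n <= g n)%N].

Definition subset_star (a b : set nat) : Prop := finite_set (a `\` b).

Definition dominating_number : Type :=
  min_card [set D : set (nat -> nat) | forall f, exists2 g, D g & le_star f g].

Definition reaping_number : Type :=
  min_card [set F : set (set nat) | F `<=` inf_subsets /\
    forall a, inf_subsets a ->
      exists2 r, F r & subset_star r a \/ subset_star r (~` a)].

Definition nowhere_dense (T : topologicalType) (A : set T) : Prop :=
  interior (closure A) = set0.

Definition meager (T : topologicalType) : set (set T) :=
  [set A | exists F : nat -> set T,
    (forall n, nowhere_dense (F n)) /\ A `<=` \bigcup_n F n].
Arguments meager : clear implicits.

Definition lebesgue_null (R : realType) : set (set R) :=
  [set A | (@lebesgue_measure R).-negligible A].
Arguments lebesgue_null : clear implicits.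

Definition cov (T : Type) (J : set (set T)) : Type :=
  min_card [set F : set (set T) | F `<=` J /\ \bigcup_(A in F) A = setT].

Definition non (T : Type) (J : set (set T)) : Type :=
  min_card [set A : set T | ~ J A].

(* Main.v *)
Require Import Defs.
From mathcomp Require Import all_boot all_order all_algebra.
From mathcomp Require Import all_classical all_reals all_analysis.
From mathcomp Require Import zify lra.
Import Order.TTheory GRing.Theory Num.Theory.
Import numFieldNormedType.Exports.

(** Each inequality [min_card P <= min_card Q] is proved by turning a family
    with property [Q] into one with property [P] that is no larger
    ([le_min_card]).

    A family as in the definition of Delta_hat is also one as in that of
    Sigma_hat, whence the middle inequality. The three upper bounds on
    Delta_hat come from three ways to produce an infinite set [A] which an
    involution [h] with at most one fixed point almost moves off itself.
    - If [g] eventually dominates [h], take the set of the iterates of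
      [n |-> n + g n + 1]: late iterates are too far apart to be exchanged by
      [h] ([thin_almost_disjoint]).
    - The set of all [n] with [n < h n] is disjoint from its image, and its
      complement is so up to a fixed point; any set [A] which is almost
      contained in either one will do ([Delta_hat_le_reaping]).
    - To a real [x], attach the set [A] of the codes of its approximations by
      cells of length [1 / L n], for all [n]. If [h] exchanges the [n]-th cell of
      [x] with an earlier one, then [x] lies in one of few intervals of length
      [1 / L n], since the earlier cell determines the [n]-th one. When [L]
      grows fast, these conditions have summable measures, so by Borel-Cantelli
      [A] works for all [x] outside a null set ([null_clash]), hence for some
      [x] in any given set that is not null.

    The lower bound is a Baire category argument. The binary digits of a real
    drive a greedy construction of an involution, in which the [n]-th digit
    tells whether to link the two members of the [n]-th pair of natural numbers
    ([greedy]). Given infinite sets [A] and [B], on a dense open set of reals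
    some new member of [A] gets linked with a new member of [B]
    ([greedy_extension]); hence, for [x] outside a meager set depending on [A]
    and [B], the involution is total, without fixed points, and maps infinitely
    many elements of [A] into [B]. So if [F] is a family as in the definition of
    Sigma_hat, the meager sets attached to the pairs of members of [F] cover the
    line ([bad_realsP]). By Baire's theorem [F] is then infinite, and there are
    no more pairs than members of [F] ([infinite_card_square]). *)

Set Implicit Arguments.
Unset Strict Implicit.
Unset Printing Implicit Defensive.

Local Open Scope classical_set_scope.
Local Open Scope card_scope.

(** * Comparing cardinal characteristics *)

(** The least families are only reached through a choice made by [xget], hence
    the need for an inhabitant of [Q]; one for [P] then comes for free. *)
Lemma le_min_card (S T : Type) (P : set (set S)) (Q : set (set T)) :
    Q !=set0 -> (forall B, Q B -> exists2 A, P A & A #<= B) ->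
  min_card P <=c min_card Q.
Proof.
move=> /ex_least_card/xgetPex-/(_ set0) [QB _] PQ.
have [A0 PA0 _] := PQ _ QB.
have /xgetPex-/(_ set0) [_ Pmin] : of_least_card P !=set0.
  by apply: ex_least_card; exists A0.
have [A PA AB] := PQ _ QB.
rewrite /cardinal_le /min_card.
rewrite (card_le_eql (card_setT _)) (card_le_eqr (card_setT _)).
exact: card_le_trans (Pmin _ PA) AB.
Qed.

Lemma cardinal_le_min (J K L : Type) :
  J <=c K -> J <=c L -> J <=c cardinal_min K L.
Proof. by rewrite /cardinal_min; case: ifP. Qed.

Lemma card_le_inj (S T : Type) (A : set S) (B : set T) (f : S -> T) :
  (forall x, A x -> B (f x)) ->
  (forall x y, A x -> A y -> f x = f y -> x = y) -> A #<= B.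
Proof.
move=> fAB finj; have fI : {in A &, injective f}.
  by move=> x y; rewrite !inE; exact: finj.
rewrite -(card_le_eql (inj_card_eq fI)); apply: subset_card_le.
by move=> _ [x Ax <-]; exact: fAB.
Qed.

Lemma card_le_ex_inj (S T : Type) (A : set S) (B : set T) : T ->
  A #<= B -> exists f : S -> T, (forall x, A x -> B (f x)) /\
    (forall x y, A x -> A y -> f x = f y -> x = y).
Proof.
move=> t /card_leP[f].
have [f' f'E] : exists f' : S -> T, forall x (Ax : A x),
    f' x = val (f (SigSub (mem_set Ax))).
  suff /choice[f' f'E] : forall x, exists y, forall Ax : A x,
    y = val (f (SigSub (mem_set Ax))) by exists f'.
  move=> x; have [Ax|nAx] := pselect (A x); last by exists t.
  by exists (val (f (SigSub (mem_set Ax)))) => Ax'; rewrite (Prop_irrelevance Ax Ax').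
exists f'; split=> [x Ax|x y Ax Ay]; rewrite ?f'E ?(f'E _ Ay).
  exact: set_valP.
move=> /val_inj fxy.
have := @inj _ _ _ f (SigSub (mem_set Ax)) (SigSub (mem_set Ay)).
by rewrite !inE => /(_ Logic.I Logic.I fxy) [].
Qed.

(** Cardinals being well-founded, the two-element collection of [A] and [B] has
    a least member. *)
Lemma card_le_total (T : Type) (A B : set T) : A #<= B \/ B #<= A.
Proof.
have [|C [[->|->] CP]] := @ex_least_card T [set A; B].
- by exists A; left.
- by left; apply: CP; right.
- by right; apply: CP; left.
Qed.

(** * An infinite set is equinumerous with its square *)

Section square.
Context (T : Type).

(** An injection of [X * X] into [X], as a relation from which a function is
    selected afterwards: unions of chains of such relations are then of the
    same kind. *)
Record square_graph (X : set T) (G : set (T * T * T)) : Prop := SquareGraph {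
  square_sub : forall p q r, G (p, q, r) -> [/\ X p, X q & X r];
  square_total : forall p q, X p -> X q -> exists r, G (p, q, r);
  square_inj : forall p q p' q' r,
    G (p, q, r) -> G (p', q', r) -> p = p' /\ q = q' }.

(** The set [X] is recovered from its graph, so that the maximality argument
    can be run on graphs alone. *)
Definition square_dom (G : set (T * T * T)) : set T :=
  [set p | exists r, G (p, p, r)].

Lemma square_graph_fun X G : square_graph X G -> exists phi : T -> T -> T,
  (forall p q, X p -> X q -> X (phi p q) /\ G (p, q, phi p q)) /\
  (forall p q p' q', X p -> X q -> X p' -> X q' ->
    phi p q = phi p' q' -> p = p' /\ q = q').
Proof.
move=> [Gsub Gtot Ginj].
have /choice[phi phiP] (u : T * T) : exists r, X u.1 -> X u.2 -> G (u, r).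
  have [Xu1|nXu] := pselect (X u.1); last by exists u.1.
  have [Xu2|nXu] := pselect (X u.2); last by exists u.1.
  by have [r ur] := Gtot _ _ Xu1 Xu2; exists r => _ _; case: (u) ur.
exists (fun p q => phi (p, q)); split=> [p q Xp Xq|p q p' q' Xp Xq Xp' Xq' E].
  have Gpq := phiP (p, q) Xp Xq; split=> //.
  by have [] := Gsub _ _ _ Gpq.
apply: (Ginj _ _ _ _ (phi (p, q))); first exact: (phiP (p, q)).
by rewrite E; exact: (phiP (p', q')).
Qed.

(** If a disjoint copy [e X] of [X] is available, the new part of the square of
    [X U e X] consists of three copies of [X * X]: a pair in it is sent to the
    copy of a code, in [X], of the underlying pair and of the constant
    [c i j] telling which of the three copies it belongs to. As the new values
    lie in [e X], they do not collide with the old ones. *)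
Lemma square_graph_extend X G (e : T -> T) (c : bool -> bool -> T) :
    square_graph X G ->
    (forall x, X x -> ~ X (e x)) ->
    (forall x y, X x -> X y -> e x = e y -> x = y) ->
    (forall i j, X (c i j)) ->
    (forall i j i' j', c i j = c i' j' -> i = i' /\ j = j') ->
  exists2 G', G `<=` G' & square_graph (X `|` e @` X) G'.
Proof.
move=> GX eX einj cX cinj; have [phi [phiX phiinj]] := square_graph_fun GX.
case: GX => Gsub Gtot Ginj.
pose eb (b : bool) x := if b then e x else x.
have ebinj b b' x x' : X x -> X x' -> eb b x = eb b' x' -> b = b' /\ x = x'.
  move=> Xx Xx'; case: b b' => [] [] //= E.
  - by rewrite (einj x x').
  - by exfalso; apply: (eX x) => //; rewrite E.
  - by exfalso; apply: (eX x') => //; rewrite -E.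
pose H (t : T * T * T) := exists i j x y, [/\ X x, X y, i || j &
  t = (eb i x, eb j y, e (phi (c i j) (phi x y)))].
have XU i x : X x -> (X `|` e @` X) (eb i x).
  by case: i => Xx; [right; exists x | left].
have UX p : (X `|` e @` X) p -> exists i x, X x /\ p = eb i x.
  by move=> [Xp|[x Xx <-]]; [exists false, p | exists true, x].
have XY i j x y : X x -> X y -> X (phi (c i j) (phi x y)).
  by move=> Xx Xy; apply: (phiX _ _ _ _).1 => //; exact: (phiX _ _ _ _).1.
exists (G `|` H); first by move=> t; left.
split=> [p q r [/Gsub[? ? ?]|[i [j [x [y [Xx Xy _ [-> -> ->]]]]]]]|p q|].
- by split; left.
- by split; try exact: XU; right; exists (phi (c i j) (phi x y)) => //; exact: XY.
- move=> /UX[i [x [Xx ->]]] /UX[j [y [Xy ->]]].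
  have [ij|] := boolP (i || j).
    by exists (e (phi (c i j) (phi x y))); right; exists i, j, x, y.
  case: i j => [] [] // _; have [r Gr] := Gtot _ _ Xx Xy.
  by exists r; left.
- move=> p q p' q' r [Gr|Hr] [Gr'|Hr'].
  + exact: Ginj Gr Gr'.
  + have [_ _ Xr] := Gsub _ _ _ Gr.
    move: Hr' => [i [j [x [y [Xx Xy _ [_ _ Er]]]]]]; exfalso.
    by apply: (eX (phi (c i j) (phi x y))); [exact: XY | rewrite -Er].
  + have [_ _ Xr] := Gsub _ _ _ Gr'.
    move: Hr => [i [j [x [y [Xx Xy _ [_ _ Er]]]]]]; exfalso.
    by apply: (eX (phi (c i j) (phi x y))); [exact: XY | rewrite -Er].
  move: Hr Hr' => [i [j [x [y [Xx Xy _ [-> -> ->]]]]]].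
  move=> [i' [j' [x' [y' [Xx' Xy' _ [-> -> /einj E]]]]]].
  have Xxy : X (phi x y) by exact: (phiX _ _ _ _).1.
  have Xxy' : X (phi x' y') by exact: (phiX _ _ _ _).1.
  have [/cinj[-> ->] /phiinj[]//] := phiinj _ _ _ _ (cX i j) Xxy (cX i' j') Xxy'
    (E (XY _ _ _ _ Xx Xy) (XY _ _ _ _ Xx' Xy')).
  by move=> -> ->.
Qed.

Lemma square_graph_nat (A : set T) : infinite_set A ->
  exists X G, [/\ X `<=` A, infinite_set X & square_graph X G].
Proof.
move=> Ainf; have [t _] := infinite_setN0 Ainf.
move/infiniteP/(card_le_ex_inj t): Ainf => [f [fA finj]].
exists (range f), [set t | exists m n, t = (f m, f n, f (pickle (m, n)))].
split; first by move=> _ [n _ <-]; exact: fA.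
  apply/infiniteP; apply: (@card_le_inj _ _ _ _ f) => [n _|]; last exact: finj.
  by exists n.
split=> [p q r [m [n [-> -> ->]]]|p q [m _ <-] [n _ <-]|].
- by split; eexists.
- by exists (f (pickle (m, n))), m, n.
move=> p q p' q' r [m [n [-> -> ->]]] [m' [n' [-> -> /finj]]].
by move=> /(_ Logic.I Logic.I) /(pcan_inj pickleK) [-> ->].
Qed.

(** Zorn's lemma applied to the graphs extending that of a pairing on a
    countably infinite subset of [A]; starting from the latter makes the domain
    of the maximal graph infinite. *)
Lemma square_graph_max (A : set T) : infinite_set A -> exists X G,
  [/\ X `<=` A, infinite_set X, square_graph X G & forall X' G',
     X' `<=` A -> G `<=` G' -> square_graph X' G' -> X' `<=` X].
Proof.
move=> Ainf; have [X0 [G0 [X0A X0inf X0G0]]] := square_graph_nat Ainf.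
have domE X G : square_graph X G -> square_dom G = X.
  move=> [Gsub Gtot _]; apply/seteqP; split=> [p [r /Gsub[]]//|p Xp].
  by have [r] := Gtot p p Xp Xp; exists r.
(* The empty graph is the union of the empty chain, and has to be allowed. *)
pose Q G := G = set0 \/
  [/\ G0 `<=` G, square_dom G `<=` A & square_graph (square_dom G) G].
have QG X G : X `<=` A -> G0 `<=` G -> square_graph X G -> Q G.
  by move=> XA G0G XG; right; rewrite (domE X).
have domS G G' : G `<=` G' -> square_dom G `<=` square_dom G'.
  by move=> GG' p [r Gr]; exists r; exact: GG'.
have [F FQ Ftot|G [QmaxG Gmax]] := @Zorn_bigcup _ Q.
  pose U := \bigcup_(G in F) G.
  have [[G1 [FG1 nG1]]|F0] := pselect (exists G, F G /\ G <> set0); last first.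
    left; apply/seteqP; split=> // t [G FG Gt].
    by apply: F0; exists G; split=> // G_0; move: Gt; rewrite G_0.
  have FU G : F G -> G `<=` U by move=> FG t Gt; exists G.
  have FP G t : F G -> G t ->
      [/\ G0 `<=` G, square_dom G `<=` A & square_graph (square_dom G) G].
    by move=> FG Gt; case: (FQ _ FG) => // G_0; move: Gt; rewrite G_0.
  have chain t t' : U t -> U t' -> exists G, [/\ F G, G t & G t'].
    move=> [G FG Gt] [G' FG' Gt']; case: (Ftot _ _ FG FG') => GG'.
      by exists G'; split=> //; exact: GG'.
    by exists G; split=> //; exact: GG'.
  right; split.
  - case: (FQ _ FG1) => // -[G0G1 _ _].
    exact: subset_trans G0G1 (FU _ FG1).
  - by move=> p [r [G FG Gr]]; have [_ + _] := FP _ _ FG Gr; apply; exists r.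
  split=> [p q r [G FG Gr]|p q [r Ur] [s Us]|].
  - have [_ _ [+ _ _]] := FP _ _ FG Gr => /(_ _ _ _ Gr)[? ? ?].
    by split; apply: (domS G) => //; exact: FU.
  - have [G [FG Gr Gs]] := chain _ _ Ur Us.
    have [_ _ [_ + _]] := FP _ _ FG Gr.
    by move=> /(_ p q)[||z Gz]; [exists r | exists s | exists z, G].
  - move=> p q p' q' r Ur Ur'; have [G [FG Gr Gr']] := chain _ _ Ur Ur'.
    by have [_ _ [_ _ Ginj]] := FP _ _ FG Gr; exact: Ginj Gr Gr'.
have : G <> set0.
  move=> G_0; apply: (Gmax G0); last exact: QG X0A _ X0G0.
  have [p Xp] := infinite_setN0 X0inf.
  have [r G0r] := square_total X0G0 Xp Xp.
  by rewrite G_0; split=> // /(_ _ G0r).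
case: QmaxG => // -[G0G GA GX] _.
exists (square_dom G), G; split=> //.
  apply: (sub_infinite_set _ X0inf).
  by rewrite -(domE _ _ X0G0); exact: domS.
move=> X' G' X'A GG' X'G'; have [G'G|nG'G] := pselect (G' `<=` G).
  by rewrite -(domE _ _ X'G'); exact: domS.
exfalso; apply: (Gmax G'); first by split.
by apply: QG X'A _ X'G'; exact: subset_trans GG'.
Qed.

(** Let [X] be the domain of a maximal graph. A copy of [X] inside [A \ X]
    would contradict maximality; so [A \ X] embeds into [X], and [A] embeds
    into two copies of [X], hence into [X * X] and into [X]. *)
Lemma infinite_card_square (A : set T) : infinite_set A -> A `*` A #<= A.
Proof.
move=> Ainf.
have [X [G [XA Xinf GX Gmax]]] := square_graph_max Ainf.
have [t _] := infinite_setN0 Ainf.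
have [f [fX finj]] := card_le_ex_inj t ((infiniteP _).1 Xinf).
have [phi [phiX phiinj]] := square_graph_fun GX.
have phiXX p q : X p -> X q -> X (phi p q) by move=> ? ?; exact: (phiX _ _ _ _).1.
have [XleAX|AXleX] := card_le_total X (A `\` X).
  have [e [eAX einj]] := card_le_ex_inj t XleAX.
  have [x|i j|i j i' j'|G' GG' X'G'] := @square_graph_extend X G e
    (fun i j => f (pickle (i, j))) GX _ einj.
  - by move=> /eAX[].
  - exact: fX.
  - by move=> /finj-/(_ Logic.I Logic.I) /(pcan_inj pickleK)[].
  have Xf : X (f 0) by exact: fX.
  have X'A : X `|` e @` X `<=` A by move=> p [/XA//|[x /eAX[? _] <-]].
  have /(Gmax _ _ X'A GG' X'G') : (X `|` e @` X) (e (f 0)).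
    by right; exists (f 0).
  by have [] := eAX _ Xf.
have [g [gX ginj]] := card_le_ex_inj t AXleX.
pose psi a := if `[< X a >] then phi (f 0) a else phi (f 1) (g a).
have Xf n : X (f n) by exact: fX.
have psiX a : A a -> X (psi a).
  move=> Aa; rewrite /psi; case: asboolP => Xa; apply: phiXX => //.
  exact: gX.
have psiinj a b : A a -> A b -> psi a = psi b -> a = b.
  move=> Aa Ab; rewrite /psi; case: asboolP => Xa; case: asboolP => Xb.
  - by move=> /phiinj[].
  - by move=> /phiinj[]//; [exact: gX | move=> /finj-/(_ Logic.I Logic.I)].
  - by move=> /phiinj[]//; [exact: gX | move=> /finj-/(_ Logic.I Logic.I)].
  - by move=> /phiinj[]//; [exact: gX| exact: gX| move=> _; apply: ginj].
apply: (@card_le_inj _ _ _ _ (fun u => phi (psi u.1) (psi u.2))).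
  by move=> [a b] [Aa Ab]; apply/XA/phiXX; exact: psiX.
move=> [a b] [a' b'] [/= Aa Ab] [/= Aa' Ab'] /phiinj[] //; try exact: psiX.
by move=> /psiinj-> // /psiinj->.
Qed.

End square.

(** * Sparse sets and the dominating number *)

Lemma finite_fixpoints h : I_omega h -> finite_set [set n | h n = n].
Proof.
move=> [_ h1]; have [[n hn]|hN] := pselect ([set n | h n = n] !=set0).
  by apply: (@sub_finite_set _ _ [set n]) => // m hm; exact: h1.
by apply: (@sub_finite_set _ _ set0) => // m hm; apply: hN; exists m.
Qed.

Lemma finite_set_ub (A : set nat) :
  finite_set A -> exists n, forall m, A m -> (m < n)%N.
Proof.
move=> /finite_seqP[s ->]; exists (\max_(i <- s) i).+1 => m /= ms.
by rewrite ltnS; apply: leq_bigmax_seq.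
Qed.

Section thin.
Context (g : nat -> nat).

Definition thin_seq (k : nat) : nat := iter k (fun n => n + (g n).+1) 0.

Lemma thin_seq_lt i j : (i < j)%N ->
  (thin_seq i < thin_seq j)%N /\ (g (thin_seq i) < thin_seq j)%N.
Proof.
elim: j => // j IH; rewrite ltnS leq_eqVlt => /predU1P[->|/IH]; rewrite /thin_seq /=; lia.
Qed.

Lemma thin_seq_inj : injective thin_seq.
Proof.
move=> i j E; case: (ltngtP i j) => // /thin_seq_lt[]; lia.
Qed.

Lemma infinite_thin : infinite_set (range thin_seq).
Proof.
apply/infiniteP; apply: (@card_le_inj _ _ _ _ thin_seq) => [n _|x y _ _].
  by exists n.
exact: thin_seq_inj.
Qed.

(** Beyond the place where [g] dominates [h], the map [h] sends a term of the
    sequence strictly below the next one. If [h] exchanged two distinct late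
    terms, it would send the smaller one to the larger one. *)
Lemma thin_almost_disjoint h : I_omega h -> le_star h g ->
  finite_set (h @` range thin_seq `&` range thin_seq).
Proof.
move=> hI /finite_set_ub[N hN].
have hg n : (N <= n)%N -> (h n <= g n)%N.
  by move=> Nn; apply: contrapT => /hN; lia.
apply: (@sub_finite_set _ _ (`I_N `|` h @` `I_N `|` [set n | h n = n])).
  move=> _ [[_ [i _ <-] <-] [j _ E]].
  have hh : h (thin_seq j) = thin_seq i by rewrite E hI.1.
  have [iN|Ni] := ltnP (thin_seq i) N; first by left; right; exists (thin_seq i).
  have [jN|Nj] := ltnP (thin_seq j) N; first by left; left; rewrite /= -E.
  right; rewrite /= hI.1; case: (ltngtP i j) => [/thin_seq_lt|/thin_seq_lt|ij].
  - by have := hg _ Ni; lia.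
  - by have := hg _ Nj; lia.
  - by rewrite ij in E *.
rewrite !finite_setU; split; [split|]; [exact: finite_II | | exact: finite_fixpoints].
by apply: finite_image; exact: finite_II.
Qed.

End thin.

Lemma le_star_refl f : le_star f f.
Proof. by apply: (@sub_finite_set _ _ set0) => // n; rewrite /= leqnn. Qed.

Lemma ex_almost_disjoint h : I_omega h ->
  exists2 A, inf_subsets A & finite_set (h @` A `&` A).
Proof.
move=> hI; exists (range (thin_seq h)); first exact: infinite_thin.
exact/thin_almost_disjoint/le_star_refl.
Qed.

Lemma Delta_hat_le_dominating : Delta_hat <=c dominating_number.
Proof.
apply: le_min_card.
  by exists setT => f; exists f => //; exact: le_star_refl.
move=> D Ddom; exists ((fun g => range (thin_seq g)) @` D); last exact: card_image_le.
split=> [_ [g _ <-]|h hI]; first exact: infinite_thin.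
have [g Dg hg] := Ddom h; exists (range (thin_seq g)); first by exists g.
exact: thin_almost_disjoint.
Qed.

(** * The reaping number *)

(** For [h] in [I_omega], let [a] be the set of all [n] with [n < h n]. The image
    of [a] misses [a], and the image of the complement of [a] meets this
    complement in a fixed point at most. So any infinite set that [a] does not
    split is almost disjoint from its image. *)
Lemma Delta_hat_le_reaping : Delta_hat <=c reaping_number.
Proof.
apply: le_min_card.
  exists inf_subsets; split=> // a ainf; exists a => //; left.
  by apply: (@sub_finite_set _ _ set0) => // n [].
move=> F [Finf Freap]; exists F; last exact: card_lexx.
split=> // h hI; pose a := [set n | (n < h n)%N].
have hK := hI.1.
have ainf : inf_subsets a.
  move=> afin; apply: infinite_nat.
  apply: (@sub_finite_set _ _ (a `|` h @` a `|` [set n | h n = n])).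
    move=> n _; case: (ltngtP n (h n)) => nh; [by left; left| |by right].
    by left; right; exists (h n); rewrite /a /= ?hK.
  rewrite !finite_setU; split; [split=> //; exact: finite_image|exact: finite_fixpoints].
have [r Fr [ra|ra]] := Freap _ ainf; exists r => //.
- apply: (@sub_finite_set _ _ (r `\` a `|` h @` (r `\` a))).
    move=> _ [[n rn <-] rhn].
    have [an|nan] := pselect (a n); last by right; exists n.
    by left; split=> //; move: an; rewrite /a /= hK; lia.
  by rewrite finite_setU; split=> //; exact: finite_image.
- apply: (@sub_finite_set _ _ ((r `\` ~` a `|` h @` (r `\` ~` a)) `|` [set n | h n = n])).
    move=> _ [[n rn <-] rhn].
    have [an|nan] := pselect (a n); first by left; right; exists n => //; split=> //; exact.
    have [ahn|nahn] := pselect (a (h n)); first by left; left; split=> //; exact.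
    by right; move: nan nahn; rewrite /a /= hK; lia.
  rewrite !finite_setU; split; [split=> //; exact: finite_image|exact: finite_fixpoints].
Qed.

(** * Approximations of a real number and the uniformity of the null ideal *)

(** The cells of level [m] will be intervals of length [1 / resolution m]; if [l]
    bounds the resolutions of the levels below [n], this list contains the codes
    of all the cells of these levels that meet [-n, n]. *)
Definition codes (n l : nat) : seq nat :=
  [seq pickle (m, i%:Z - (n * l)%:Z)%R | m <- iota 0 n, i <- iota 0 (2 * (n * l)).+1].

Lemma size_codes n l : size (codes n l) = n * (2 * (n * l)).+1.
Proof. by rewrite size_allpairs !size_iota. Qed.

Lemma mem_codes n l m (j : int) : (m < n)%N -> (`|j| <= n * l)%N ->
  pickle (m, j) \in codes n l.
Proof.
move=> mn jl; apply/allpairsP; exists (m, `|(j + (n * l)%:Z)%R|%N).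
split; rewrite ?[_.1]/= ?[_.2]/= ?mem_iota; [lia|lia|].
by congr (pickle (m, _)); lia.
Qed.

(** The resolution of level [n] outgrows the number of cells of the earlier levels
    by a factor that makes the measures in [measure_clash_set] summable. *)
Fixpoint resolution (n : nat) : nat :=
  if n is n'.+1 then 2 ^ n.+1 * size (codes n (resolution n')) else 1.

Lemma resolutionS n :
  resolution n.+1 = (2 ^ n.+2 * (n.+1 * (2 * (n.+1 * resolution n)).+1))%N.
Proof. by rewrite -size_codes. Qed.

Lemma leq_resolution m n : (m <= n)%N -> (resolution m <= resolution n)%N.
Proof.
move=> /subnK <-; elim: (n - m)%N => // k IH; apply: (leq_trans IH).
rewrite addSn resolutionS; set l := resolution _.
have : (0 < 2 ^ (k + m).+2)%N by rewrite expn_gt0.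
nia.
Qed.

Lemma resolution_gt0 n : (0 < resolution n)%N.
Proof. exact: (@leq_resolution 0). Qed.

Section null.
Context (R : realType).
Local Open Scope ring_scope.
Implicit Types (x : R) (h : nat -> nat).

Definition cell (x : R) (n : nat) : nat :=
  pickle (n, Num.floor ((resolution n)%:R * x)).

Lemma cell_inj x m n : cell x m = cell x n -> m = n.
Proof. by move=> /(pcan_inj pickleK)[]. Qed.

Lemma infinite_cells x : infinite_set (range (cell x)).
Proof.
apply/infiniteP; apply: (@card_le_inj _ _ _ _ (cell x)) => [n _|m n _ _].
  by exists n.
exact: cell_inj.
Qed.

Lemma mem_cell x m n : (m < n)%N -> `|x| <= n%:R ->
  cell x m \in codes n (resolution n.-1).
Proof.
move=> mn xn; apply: mem_codes => //.
have lm : (resolution m <= resolution n.-1)%N by apply: leq_resolution; lia.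
have : `|(resolution m)%:R * x| <= (n * resolution n.-1)%:R.
  rewrite normrM normr_nat mulrC natrM ler_pM //; by rewrite ler_nat.
rewrite ler_norml => /andP[x1 x2].
have : - (n * resolution n.-1)%:Z <= Num.floor ((resolution m)%:R * x).
  by rewrite floor_ge_int rmorphN.
have : Num.floor ((resolution m)%:R * x) <= (n * resolution n.-1)%:Z.
  by rewrite -ltzD1 floor_lt_int intrD; apply: (le_lt_trans x2); rewrite ltrDl.
lia.
Qed.

(** The interval of reals whose [n]-th cell has code [w], if there are any;
    otherwise some interval of the same length, which is harmless since these
    sets only serve as covers. *)
Definition cell_set (n w : nat) : set R :=
  let j : int := (odflt (0%N, 0) (unpickle w)).2 in
  `[(j%:~R / (resolution n)%:R), ((j + 1)%:~R / (resolution n)%:R)[%classic.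

Lemma mem_cell_set x n : cell_set n (cell x n) x.
Proof.
have m0 : (0 : R) < (resolution n)%:R by rewrite ltr0n resolution_gt0.
rewrite /cell_set /cell pickleK /= in_itv /=.
rewrite ler_pdivrMr // ltr_pdivlMr // mulrC; exact: floor_itv.
Qed.

Lemma measurable_cell_set n w : measurable (cell_set n w).
Proof. exact: measurable_itv. Qed.

Lemma measure_cell_set n w :
  lebesgue_measure (cell_set n w) = ((resolution n)%:R^-1)%:E.
Proof.
have m0 : (0 : R) < (resolution n)%:R^-1 by rewrite invr_gt0 ltr0n resolution_gt0.
rewrite /cell_set lebesgue_measure_itv /= lte_fin ifT.
  by rewrite -EFinB -mulrBl intrD addrAC subrr add0r mul1r.
by rewrite ltr_pM2r // intrD ltrDl.
Qed.

Lemma measure_bigsetU_le (d : measure_display) (T : measurableType d)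
    (mu : {measure set T -> \bar R}) (I : Type) (s : seq I) (E : I -> set T) (c : R) :
    (forall i, measurable (E i)) -> (forall i, (mu (E i) <= c%:E)%E) ->
  (mu (\big[setU/set0]_(i <- s) E i) <= (c *+ size s)%:E)%E.
Proof.
move=> mE Ec; elim: s => [|i s IH]; first by rewrite big_nil measure0.
rewrite big_cons /= mulrS EFinD.
apply: (@le_trans _ _ (mu (E i) + mu (\big[setU/set0]_(j <- s) E j))%E).
  by apply: measureU2 => //; exact: bigsetU_measurable.
exact: leeD.
Qed.

(** The reals of [-n, n] for which [h] exchanges the [n]-th cell with an earlier
    one belong to this set: once the earlier cell is known, [h] determines the
    [n]-th one. *)
Definition clash_set h (n : nat) : set R :=
  \big[setU/set0]_(v <- codes n (resolution n.-1)) cell_set n (h v).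

Lemma measurable_clash_set h n : measurable (clash_set h n).
Proof. by apply: bigsetU_measurable => v _; exact: measurable_cell_set. Qed.

Lemma measure_clash_set h n :
  (lebesgue_measure (clash_set h n) <= (1 / (2 ^ n.+1)%:R)%:E)%E.
Proof.
apply: le_trans; first apply: (@measure_bigsetU_le _ _ (@lebesgue_measure R) _
  _ (fun v => cell_set n (h v)) (resolution n)%:R^-1).
- by move=> v; exact: measurable_cell_set.
- by move=> v; rewrite -(measure_cell_set n (h v)).
rewrite lee_fin size_codes; case: n => [|n]; first by rewrite mulr0n divr_ge0.
rewrite resolutionS; set c := (n.+1 * _)%N.
have c0 : (0 : R) < c%:R by rewrite ltr0n /c; lia.
rewrite -[_ *+ c]mulr_natr natrM invfM -mulrA mulVf ?gt_eqF //.
by rewrite mulr1 mul1r.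
Qed.

Lemma clash_cell x h m n : (m < n)%N -> `|x| <= n%:R ->
  cell x n = h (cell x m) -> clash_set h n x.
Proof.
move=> mn xn E; rewrite /clash_set -bigcup_seq; exists (cell x m).
  exact: mem_cell.
by rewrite -E; exact: mem_cell_set.
Qed.

Lemma null_clash h : lebesgue_measure (lim_sup_set (clash_set h)) = 0%E.
Proof.
apply: lim_sup_set_cvg0; first exact: measurable_clash_set.
apply: le_lt_trans (ltry 1).
apply: le_trans (epsilon_trick0 xpredT ler01).
by apply: lee_nneseries => // n _; exact: measure_clash_set.
Qed.

(** Outside the null set of [null_clash], only cells of bounded levels can be
    exchanged by [h], apart from a cell which is fixed. *)
Lemma cells_almost_disjoint h x : I_omega h -> ~ lim_sup_set (clash_set h) x ->
  finite_set (h @` range (cell x) `&` range (cell x)).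
Proof.
move=> hI xE; have hK := hI.1.
have [N [xN NP]] : exists N : nat, `|x| <= N%:R /\
    forall n, (N <= n)%N -> ~ clash_set h n x.
  have [N0 NP] : exists N, forall n, (N <= n)%N -> ~ clash_set h n x.
    apply: contrapT => noN; apply: xE => N _; apply: contrapT => nN.
    by apply: noN; exists N => n Nn xn; apply: nN; exists n.
  exists (maxn N0 (Num.truncn `|x|).+1); split.
    by apply: (le_trans (ltW (truncnS_gt _))); rewrite ler_nat leq_maxr.
  by move=> n Nn; apply: NP; lia.
have noclash m n : (m < n)%N -> (N <= n)%N -> cell x n <> h (cell x m).
  move=> mn Nn /(clash_cell mn) xn; apply: (NP n Nn); apply: xn.
  by apply: (le_trans xN); rewrite ler_nat.
apply: (@sub_finite_set _ _ (cell x @` `I_N `|` [set n | h n = n])).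
  move=> _ [[_ [n _ <-] <-] [m _ E]].
  have [mN|Nm] := ltnP m N; first by left; exists m.
  case: (ltngtP m n) => [mn|nm|mn].
  - exfalso; apply: (noclash m n) => //; first by lia.
    by rewrite E hK.
  - by exfalso; apply: (noclash n m).
  - by right; rewrite /= hK -E mn.
rewrite finite_setU; split; last exact: finite_fixpoints.
by apply: finite_image; exact: finite_II.
Qed.

(** A set of reals which is not null is not contained in the null set of
    [null_clash], whichever [h] is given. *)
Lemma Delta_hat_le_non_null : Delta_hat <=c non (lebesgue_null R).
Proof.
apply: le_min_card.
  exists setT => -[B [mB B0 /(_ _ Logic.I) BT]].
  pose I : set R := `[0, 1]%classic.
  have : (lebesgue_measure I <= lebesgue_measure B)%E.
    by apply: le_measure; rewrite ?inE //; exact: measurable_itv.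
  by rewrite B0 /I lebesgue_measure_itv /= lte_fin ltr01 sube0 lee_fin ler10.
move=> X Xnull; exists ((fun x => range (cell x)) @` X); last exact: card_image_le.
split=> [_ [x _ <-]|h hI]; first exact: infinite_cells.
have [x Xx xE] : exists2 x, X x & ~ lim_sup_set (clash_set h) x.
  apply: contrapT => nx; apply: Xnull; exists (lim_sup_set (clash_set h)); split.
  - apply: bigcap_measurable => // k _; apply: bigcup_measurable => n _.
    exact: measurable_clash_set.
  - exact: null_clash.
  - by move=> x Xx; apply: contrapT => xE; apply: nx; exists x.
exists (range (cell x)); first by exists x.
exact: cells_almost_disjoint.
Qed.

End null.

(** * Greedy involutions *)

Section greedy.
Implicit Types d : nat -> bool.

Definition link (a b : nat) (h : nat -> nat) (z : nat) : nat :=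
  if z == a then b else if z == b then a else h z.

(** The default value is harmless: linking a number with itself has no
    effect. *)
Definition coded_pair (n : nat) : nat * nat := odflt (0, 0) (unpickle n).

(** The pairs of natural numbers are considered in turn, and the [n]-th one is
    linked when the digit [d n] asks for it and both its members are still
    free, that is fixed. *)
Fixpoint greedy d (n : nat) : nat -> nat :=
  if n is n'.+1 then
    let h := greedy d n' in let: (a, b) := coded_pair n' in
    if [&& d n', h a == a & h b == b] then link a b h else h
  else id.

Lemma coded_pairK u : coded_pair (pickle u) = u.
Proof. by rewrite /coded_pair pickleK. Qed.

Lemma greedyK d n : involutive (greedy d n).
Proof.
elim: n => //= n IH; case: (coded_pair n) => a b.
case: ifP => // /and3P[_ /eqP ha /eqP hb] z; rewrite /link.
case: (eqVneq z a) => [->|za]; first by rewrite /= !eqxx; case: eqVneq.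
case: (eqVneq z b) => [->|zb]; first by rewrite /= eqxx.
rewrite ifN; last by apply: contra_neq za => hz; rewrite -[z]IH hz ha.
rewrite ifN; last by apply: contra_neq zb => hz; rewrite -[z]IH hz hb.
exact: IH.
Qed.

Lemma greedy_stable d m n z : (m <= n)%N -> greedy d m z <> z ->
  greedy d n z = greedy d m z.
Proof.
move=> /subnK <-; elim: (n - m)%N => // k IH hz; rewrite addSn /=.
case: (coded_pair _) => a b; case: ifP => [/and3P[_ /eqP ha /eqP hb]|_]; last exact: IH.
rewrite /link; case: eqVneq => [za|_]; first by case: (hz); rewrite -IH // za.
case: eqVneq => [zb|_]; first by case: (hz); rewrite -IH // zb.
exact: IH.
Qed.

Lemma greedy_prefix d d' n : (forall i, (i < n)%N -> d i = d' i) ->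
  greedy d n = greedy d' n.
Proof.
elim: n => //= n IH dd'; rewrite IH; last by move=> i ?; apply: dd'; lia.
by rewrite dd'.
Qed.

Lemma greedy_bound d n : exists N, forall z, (N <= z)%N -> greedy d n z = z.
Proof.
elim: n => [|n [N IH]] /=; first by exists 0.
case: (coded_pair n) => a b; exists (maxn N (maxn a b).+1) => z Nz.
case: ifP => _; last by apply: IH; lia.
by rewrite /link !ifN; [apply: IH; lia|lia|lia].
Qed.

Lemma greedy_const d n k : (n <= k)%N ->
  (forall i, (n <= i < k)%N -> d i = false) -> greedy d k = greedy d n.
Proof.
move=> /subnK <-; elim: (k - n)%N => //= j IH dF.
case: (coded_pair _) => a b; rewrite dF /=; last by lia.
by apply: IH => i ?; apply: dF; lia.
Qed.

Lemma greedy_link d n a b : (n <= pickle (a, b))%N ->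
    (forall i, (n <= i < pickle (a, b))%N -> d i = false) ->
    d (pickle (a, b)) -> greedy d n a = a -> greedy d n b = b ->
  greedy d (pickle (a, b)).+1 a = b.
Proof.
move=> nk dF dT ha hb.
by rewrite [LHS]/= coded_pairK (greedy_const nk dF) dT ha hb !eqxx /= /link eqxx.
Qed.

(** Once every number has been linked, the stages stabilize to an involution
    without fixed points. *)
Lemma greedy_limit d : (forall c, exists n, greedy d n c <> c) ->
  exists2 h, I_omega h & forall c n, greedy d n c <> c -> h c = greedy d n c.
Proof.
move=> /choice[N NP]; pose h c := greedy d (N c) c.
have hE c n : greedy d n c <> c -> h c = greedy d n c.
  move=> nc; rewrite /h; case: (leqP n (N c)) => nN.
    exact: greedy_stable.
  by rewrite (@greedy_stable d (N c) n) // ltnW.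
exists h => //; split=> [c|c c' /= hc]; last by exfalso; exact: (NP c).
have E : greedy d (N c) (h c) = c by rewrite /h greedyK.
by rewrite (hE _ (N c)) E //; apply/nesym; exact: NP.
Qed.

End greedy.

(** * Meager sets of reals *)

Section baire_category.
Context (R : realType).
Local Open Scope ring_scope.

Lemma nowhere_denseP (A : set R) :
    (forall U : set R, open U -> U !=set0 ->
      exists V : set R, [/\ open V, V !=set0, V `<=` U & V `&` A = set0]) ->
  nowhere_dense A.
Proof.
move=> AP; apply/seteqP; split=> // x xA.
have [V [Vo [y Vy] VA VA0]] := AP _ (@open_interior _ (closure A)) (ex_intro _ x xA).
have [z [Az Vz]] : (A `&` V) !=set0.
  by apply: (interior_subset (VA _ Vy)); exact: open_nbhs_nbhs.
by move: VA0; apply/eqP/set0P; exists z.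
Qed.

(** Baire's theorem, for the complements of the closures. *)
Lemma not_meagerT : ~ meager R setT.
Proof.
move=> [F [Fnd Fcov]].
have [n|||x [_ xF]] := @Baire R R^o (fun n => ~` closure (F n)) _ setT.
- split; first by apply: closed_openC; exact: closed_closure.
move=> U [x Ux] Uo; apply: contrapT => UF.
have : interior (closure (F n)) x.
  move: (open_nbhs_nbhs (conj Uo Ux)); apply: filterS => y Uy.
  by apply: contrapT => nFy; apply: UF; exists y.
by rewrite (Fnd n).
- by exists 0.
- exact: openT.
have [n _ Fnx] := Fcov x Logic.I.
by apply: (xF n) => //; exact: subset_closure.
Qed.

Lemma meager_bigcup (I : Type) (D : set I) (M : I -> set R) :
  countable D -> (forall i, D i -> meager R (M i)) ->
  meager R (\bigcup_(i in D) M i).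
Proof.
move=> /(card_le_ex_inj 0%N)[f [_ finj]] DM.
have /choice[G GP] i : exists G : nat -> set R, D i ->
    (forall n, nowhere_dense (G n)) /\ M i `<=` \bigcup_n G n.
  have [/DM[G ?]|nDi] := pselect (D i); first by exists G.
  by exists (fun=> set0).
(* An injection [f] of [D] into the natural numbers turns the indices
   [(f i, n)] into natural numbers; the union below has at most one term. *)
exists (fun m => \bigcup_(i in [set i | D i /\ f i = (coded_pair m).1])
  G i (coded_pair m).2); split=> [m|x [i Di Mix]]; last first.
  have [_ /(_ _ Mix)[n _ Gx]] := GP _ Di.
  by exists (pickle (f i, n)) => //; rewrite coded_pairK; exists i.
have [[i [Di fi]]|nD] := pselect (exists i, D i /\ f i = (coded_pair m).1); last first.
  rewrite bigcup0; last by move=> i Hi; exfalso; apply: nD; exists i.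
  by rewrite /nowhere_dense closure0 interior0.
rewrite (_ : [set i | _] = [set i]) ?bigcup_set1; first exact: (GP _ Di).1.
apply/seteqP; split=> [j [Dj fj]|j ->//]; by apply: finj => //; rewrite fj fi.
Qed.

End baire_category.

(** * Binary digits as Cohen reals *)

Section digits.
Context (R : realType).
Local Open Scope ring_scope.

Definition digit (x : R) (n : nat) : bool := odd `|Num.floor (2 ^+ n * x)|%N.

Lemma floor_coarser (x y : R) i m : (i <= m)%N ->
  Num.floor (2 ^+ m * x) = Num.floor (2 ^+ m * y) ->
  Num.floor (2 ^+ i * x) = Num.floor (2 ^+ i * y).
Proof.
move=> im E; apply: esym; apply: floor_def.
have p0 : (0 : R) < 2 ^+ (m - i) by rewrite exprn_gt0.
have e2 z : 2 ^+ m * z = 2 ^+ (m - i) * (2 ^+ i * z) :> R.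
  by rewrite mulrA -exprD subnK.
set a := Num.floor (2 ^+ i * x).
have /andP[ax xa] : a%:~R <= 2 ^+ i * x < (a + 1)%:~R by exact: floor_itv.
have eint (b : int) : (2 ^+ (m - i) * b)%:~R = 2 ^+ (m - i) * b%:~R :> R.
  by rewrite intrM rmorphXn.
apply/andP; split.
  rewrite -(ler_pM2l p0) -e2 -eint -floor_ge_int -E floor_ge_int eint e2.
  by rewrite ler_pM2l.
rewrite -(ltr_pM2l p0) -e2 -eint -floor_lt_int -E floor_lt_int eint e2.
by rewrite ltr_pM2l.
Qed.

(** The condition on [y] says that its [k]-th binary digit is the first nonzero
    one after the [m]-th. *)
Lemma floor_near (m k : nat) (j : int) (y : R) (i : nat) :
    (m <= i < k)%N -> (2 ^+ k)^-1 < y - j%:~R / 2 ^+ m < 2 * (2 ^+ k)^-1 ->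
  Num.floor (2 ^+ i * y) = 2 ^+ (i - m) * j.
Proof.
move=> /andP[mi ik] /andP[y1 y2]; apply: floor_def.
have pi : (0 : R) < 2 ^+ i by rewrite exprn_gt0.
have pm : (0 : R) < 2 ^+ m by rewrite exprn_gt0.
have pk : (0 : R) < 2 ^+ k by rewrite exprn_gt0.
rewrite intrD intrM rmorphXn /=.
have -> : 2 ^+ (i - m) * j%:~R = 2 ^+ i * (j%:~R / 2 ^+ m) :> R.
  by rewrite expfB_cond ?pnatr_eq0 //= -mulrA [_^-1 * _]mulrC.
have k0 : (0 : R) < (2 ^+ k)^-1 by rewrite invr_gt0.
have ik1 : 2 ^+ i * (2 * (2 ^+ k)^-1) <= 1 :> R.
  by rewrite mulrA -exprSr ler_pdivrMr // mul1r ler_eXn2l // ltr1n.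
apply/andP; split; first by rewrite ler_pM2l //; lra.
have : 2 ^+ i * (y - j%:~R / 2 ^+ m) < 2 ^+ i * (2 * (2 ^+ k)^-1).
  by rewrite ltr_pM2l.
rewrite mulrBr; lra.
Qed.

(** This is the only link between the topology of the line and binary digits:
    every open set contains a dyadic interval, inside which the later digits
    can be prescribed. Prescribing zeros followed by a one suffices. *)
Lemma digit_extension (U : set R) (x : R) : open U -> U x ->
  exists n, forall k, (n <= k)%N ->
    exists V : set R, [/\ open V, V !=set0, V `<=` U & forall y, V y ->
      [/\ forall i, (i < n)%N -> digit y i = digit x i,
          forall i, (n <= i < k)%N -> digit y i = false & digit y k]].
Proof.
move=> Uo Ux.
have /nbhs_ballP[e /= e0 eU] : nbhs x U by exact: open_nbhs_nbhs.
have [m me] : exists m, (2 ^+ m)^-1 < e :> R.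
  exists (Num.truncn e^-1).+1.
  rewrite invf_plt ?posrE ?exprn_gt0 //.
  apply: (lt_trans (truncnS_gt _)).
  by rewrite -natrX ltr_nat ltn_expl.
(* The digits up to the [m]-th one are shared by all points of the dyadic
   interval of length [2 ^- m] around [x], which lies in [U]. *)
exists m.+1 => k mk; set j := Num.floor (2 ^+ m * x).
have pm : (0 : R) < 2 ^+ m by rewrite exprn_gt0.
have pk : (0 : R) < 2 ^+ k by rewrite exprn_gt0.
have k0 : (0 : R) < (2 ^+ k)^-1 by rewrite invr_gt0.
pose c : R := j%:~R / 2 ^+ m.
exists `](c + (2 ^+ k)^-1), (c + 2 * (2 ^+ k)^-1)[%classic.
have VP y : `](c + (2 ^+ k)^-1), (c + 2 * (2 ^+ k)^-1)[%classic y ->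
    (2 ^+ k)^-1 < y - j%:~R / 2 ^+ m < 2 * (2 ^+ k)^-1.
  by rewrite /= in_itv /= -/c; lra.
have Vj y : `](c + (2 ^+ k)^-1), (c + 2 * (2 ^+ k)^-1)[%classic y ->
    Num.floor (2 ^+ m * y) = j.
  by move=> /VP/(@floor_near _ _ _ _ m)->; [rewrite subnn expr0 mul1r|lia].
split.
- exact: interval_open.
- exists (c + 3 / 2 * (2 ^+ k)^-1) => /=; rewrite in_itv /=; lra.
- move=> y Vy; apply: eU; rewrite /ball /=; apply: le_lt_trans me.
  have /andP[] := floor_itv (2 ^+ m * x); rewrite -/j.
  have /andP[] := floor_itv (2 ^+ m * y); rewrite Vj // intrD.
  move=> y1 y2 x1 x2; rewrite -(ler_pM2l pm) mulfV ?gt_eqF //.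
  rewrite -{1}(gtr0_norm pm) -normrM mulrBr ler_norml; lra.
move=> y Vy; split=> [i im|i /andP[mi ik]|].
- rewrite /digit (@floor_coarser y x i m) //; exact: Vj.
- rewrite /digit (floor_near _ (VP _ Vy)); last by lia.
  by rewrite abszM oddM abszX oddX /=; case: (i - m)%N (subn_gt0 m i) => //; lia.
rewrite /digit (_ : Num.floor _ = 2 ^+ (k - m) * j + 1); last first.
  have /andP[y1 y2] := VP _ Vy; apply: floor_def.
  rewrite !intrD intrM rmorphXn /=.
  have -> : 2 ^+ (k - m) * j%:~R = 2 ^+ k * (j%:~R / 2 ^+ m) :> R.
    by rewrite expfB_cond ?pnatr_eq0 //= -?mulrA ?[_^-1 * _]mulrC //; lia.
  have : 2 ^+ k * (2 ^+ k)^-1 < 2 ^+ k * (y - j%:~R / 2 ^+ m) by rewrite ltr_pM2l.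
  have : 2 ^+ k * (y - j%:~R / 2 ^+ m) < 2 ^+ k * (2 * (2 ^+ k)^-1).
    by rewrite ltr_pM2l.
  rewrite mulrCA mulfV ?gt_eqF // mulrBr; lra.
have -> : 2 ^+ (k - m) = 2 * 2 ^+ (k - m).-1 :> int.
  by rewrite -exprS; congr (_ ^+ _); lia.
lia.
Qed.

Definition greedy_of (x : R) := greedy (digit x).

Definition unmatched (c : nat) : set R := [set x | forall n, greedy_of x n c = c].

Definition unlinked (A B : set nat) (k : nat) : set R :=
  [set x | forall a b n, A a -> B b -> (k <= b)%N -> a <> b ->
    greedy_of x n a <> b].

(** In an open set, the first [n] stages can be frozen to a map [h] of finite
    support; any pair coded after [n] whose members are free for [h] can then
    be linked on a smaller open set, by keeping idle until its turn. *)
Lemma greedy_extension (U : set R) : open U -> U !=set0 ->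
  exists h n N, [/\ forall z, (N <= z)%N -> h z = z,
    exists V : set R, [/\ open V, V !=set0, V `<=` U &
      forall y, V y -> greedy_of y n = h] &
    forall a b, (n <= pickle (a, b))%N -> h a = a -> h b = b ->
      exists V : set R, [/\ open V, V !=set0, V `<=` U &
        forall y, V y -> greedy_of y (pickle (a, b)).+1 a = b]].
Proof.
move=> Uo [x Ux]; have [n nP] := digit_extension Uo Ux.
have [N NP] := greedy_bound (digit x) n.
exists (greedy_of x n), n, N; split=> // [|a b nk ha hb].
  have [V [Vo V0 VU VP]] := nP n (leqnn _); exists V; split=> // y /VP[yx _ _].
  exact: greedy_prefix.
have [V [Vo V0 VU VP]] := nP _ nk; exists V; split=> // y /VP[yx y0 y1].
by apply: (greedy_link nk) => //; rewrite (greedy_prefix yx).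
Qed.

Lemma infinite_pickle (B : set nat) (a n N : nat) : infinite_set B ->
  exists b, [/\ B b, (N <= b)%N & (n <= pickle (a, b))%N].
Proof.
move=> Binf; apply: contrapT => nb; apply: Binf.
apply: (@sub_finite_set _ _ (`I_N `|` (fun b => pickle (a, b)) @^-1` `I_n)).
  move=> b Bb; have [bN|Nb] := ltnP b N; first by left.
  right=> /=; rewrite ltnNge; apply/negP => nk.
  by apply: nb; exists b.
rewrite finite_setU; split; first exact: finite_II.
apply: finite_preimage; last exact: finite_II.
by move=> b b' _ _ /(pcan_inj pickleK)[].
Qed.

Lemma nowhere_dense_unmatched c : nowhere_dense (unmatched c).
Proof.
apply: nowhere_denseP => U Uo U0.
have [h [n [N [hN [V [Vo V0 VU Vh]] hext]]]] := greedy_extension Uo U0.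
have [hc|hc] := pselect (h c = c); last first.
  exists V; split=> //; apply/seteqP; split=> // y [/Vh yh /(_ n)].
  by rewrite yh.
have [b [_ Nb nk]] := infinite_pickle c n (maxn N c.+1) infinite_nat.
have hb : h b = b by apply: hN; lia.
have [W [Wo W0 WU WP]] := hext _ _ nk hc hb.
exists W; split=> //; apply/seteqP; split=> // y [/WP yb] /(_ _) yc.
by move: yb; rewrite yc; lia.
Qed.

Lemma nowhere_dense_unlinked (A B : set nat) k :
  infinite_set A -> infinite_set B -> nowhere_dense (unlinked A B k).
Proof.
move=> Ainf Binf; apply: nowhere_denseP => U Uo U0.
have [h [n [N [hN _ hext]]]] := greedy_extension Uo U0.
have [a [Aa Na _]] := infinite_pickle 0 0 N Ainf.
have [b [Bb Nb nk]] := infinite_pickle a n (maxn N (maxn k a.+1)) Binf.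
have [||W [Wo W0 WU WP]] := hext _ _ nk; [by apply: hN | by apply: hN; lia |].
exists W; split=> //; apply/seteqP; split=> // y [/WP yb] yu.
by apply: (yu _ _ _ Aa Bb _ _ yb); lia.
Qed.

(** The union over [c] does not depend on [A] and [B]; putting it in each of
    these sets lets one family, indexed by pairs of sets, cover the line. *)
Definition bad_reals (A B : set nat) : set R :=
  \bigcup_c unmatched c `|` \bigcup_k unlinked A B k.

Lemma meager_bad_reals (A B : set nat) :
  infinite_set A -> infinite_set B -> meager R (bad_reals A B).
Proof.
move=> Ainf Binf.
exists (fun n => if odd n then unmatched n./2 else unlinked A B n./2); split=> [n|].
  case: ifP => _; first exact: nowhere_dense_unmatched.
  exact: nowhere_dense_unlinked.
move=> x [[c _ xc]|[k _ xk]].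
  by exists c.*2.+1 => //=; rewrite odd_double /= uphalf_double.
by exists k.*2 => //; rewrite odd_double doubleK.
Qed.

(** A real outside every [unmatched c] defines an [h] in [I_omega], which the
    family [F] defeats for some [A] and [B]: this makes the real unlinked for
    them. *)
Lemma bad_realsP (F : set (set nat)) (x : R) :
    (forall h, I_omega h ->
      exists A B, [/\ F A, F B & finite_set (h @` A `&` B)]) ->
  exists A B, [/\ F A, F B & bad_reals A B x].
Proof.
move=> FS; have [xm|xu] := pselect (forall c, exists n, greedy_of x n c <> c).
  have [h hI hx] := greedy_limit xm; have [A [B [FA FB hAB]]] := FS h hI.
  have [k kP] := finite_set_ub hAB.
  exists A, B; split=> //; right; exists k => // a b n Aa Bb kb ab xab.
  have hab : h a = b by rewrite (hx _ n) -[greedy _ _]/(greedy_of x n) xab //; exact/nesym.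
  by have := kP b; rewrite ltnNge kb => /(_ (conj (ex_intro2 _ _ a Aa hab) Bb)).
(* Any member of [I_omega], such as the exchange of [2 k] and [2 k + 1], shows
   that [F] is not empty. *)
have [|A [B [FA FB _]]] := FS (fun n => if odd n then n.-1 else n.+1).
  split=> [n|n n' /=]; last by case: ifP; lia.
  by case: (boolP (odd n)) => on; case: ifP; lia.
exists A, B; split=> //; left; apply: contrapT => nx; apply: xu => c.
apply: contrapT => nc; apply: nx; exists c => // n; apply: contrapT => xc.
by apply: nc; exists n.
Qed.

(** The meager sets are indexed by pairs of members of [F], whence the recourse
    to [infinite_card_square]; [F] is infinite because a countable family of
    meager sets does not cover the line. *)
Lemma cov_meager_le_Sigma_hat : cov (meager R) <=c Sigma_hat.
Proof.
apply: le_min_card.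
  exists inf_subsets; split=> // h /ex_almost_disjoint[A Ainf Afin].
  by exists A, A.
move=> F [Finf FS].
have cover : \bigcup_(u in F `*` F) bad_reals u.1 u.2 = setT.
  apply/seteqP; split=> // x _; have [A [B [FA FB xAB]]] := bad_realsP x FS.
  by exists (A, B).
have FM u : (F `*` F) u -> meager R (bad_reals u.1 u.2).
  by move=> [/Finf Ainf /Finf Binf]; exact: meager_bad_reals.
exists ((fun u => bad_reals u.1 u.2) @` (F `*` F)).
  split=> [_ [u Fu <-]|]; first exact: FM.
  by rewrite bigcup_image.
apply: card_le_trans (card_image_le _ _) _; apply: infinite_card_square => Ffin.
apply: (@not_meagerT R); rewrite -cover; apply: meager_bigcup => //.
by apply: finite_set_countable; exact: finite_setX.
Qed.

End digits.

(** * The diagram of inequalities *)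

Lemma Sigma_hat_le_Delta_hat : Sigma_hat <=c Delta_hat.
Proof.
apply: le_min_card.
  by exists inf_subsets; split=> // h hI; exact: ex_almost_disjoint.
move=> F [Finf FD]; exists F; last exact: card_lexx.
by split=> // h /FD[A FA Afin]; exists A, A.
Qed.

Theorem theorem7p1 (R : realType) :
  [/\ cov (meager R) <=c Sigma_hat,
      Sigma_hat <=c Delta_hat &
      Delta_hat <=c cardinal_min dominating_number
                      (cardinal_min reaping_number (non (lebesgue_null R)))].
Proof.
split; [exact: cov_meager_le_Sigma_hat | exact: Sigma_hat_le_Delta_hat |].
apply: cardinal_le_min; first exact: Delta_hat_le_dominating.
apply: cardinal_le_min; first exact: Delta_hat_le_reaping.
exact: Delta_hat_le_non_null.
Qed.
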